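(* Let $d\ge 3$. Every rational simplicial $d$-cone $C\subset\mathbb{R}^d$ admits a unimodular triangulation $C=D_1\cup\dots\cup D_T$ such that $$\mathrm{Hilb}(D_t)\subset\Bigl(\frac d2\Bigl(\frac32\Bigr)^{\mu(\Delta_C)-2}\Bigr)\Delta_C,\qquad t\in[1,T].$$
   Context: Cones are polyhedral, rational, pointed; $\mathrm{Hilb}(C)$ is the minimal generating set of the semigroup $C\cap\mathbb{Z}^d$; extreme integral generators of $C$ are the primitive lattice vectors on the edges of $C$; $\Delta_C$ is the convex hull of $O$ and the extreme integral generators. For a lattice simplex with vertices $v_0,\dots,v_e$, $\mu$ denotes its multiplicity: the index of the subgroup $U$ generated by $v_i-v_0$ in the smallest direct summand of $\mathbb{Z}^d$ containing $U$ (for full-dimensional simplices, $d!$ times the volume). A unimodular cone is a simplicial cone $D$ with $\mu(\Delta_D)=1$. A unimodular triangulation of $C$ is a finite family of unimodular cones with union $C$ any two of which intersect in a common face. $c\Delta_C$ is the dilate with center $O$. *)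

(* Defs.v *)
From HB Require Import structures.
From mathcomp Require Import all_boot all_order all_algebra.
From mathcomp Require Import boolp classical_sets reals.
Set Implicit Arguments. Unset Strict Implicit. Unset Printing Implicit Defensive.
Import Order.TTheory GRing.Theory Num.Theory.
Local Open Scope ring_scope.
Local Open Scope classical_set_scope.

Definition intv (R : realType) (d : nat) (z : 'rV[int]_d) : 'rV[R]_d :=
  map_mx (fun k : int => k%:~R) z.
Definition intm (R : realType) (m d : nat) (M : 'M[int]_(m, d)) : 'M[R]_(m, d) :=
  map_mx (fun k : int => k%:~R) M.

Definition lattice (R : realType) (d : nat) : set 'rV[R]_d :=
  [set x | exists z : 'rV[int]_d, x = intv R z].

Definition cone (R : realType) (m d : nat) (M : 'M[R]_(m, d)) : set 'rV[R]_d :=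
  [set x | exists a : 'rV[R]_m, (forall i, 0 <= a 0 i) /\ x = a *m M].

Definition simplex0 (R : realType) (m d : nat) (M : 'M[R]_(m, d)) : set 'rV[R]_d :=
  [set x | exists a : 'rV[R]_m,
     (forall i, 0 <= a 0 i) /\ \sum_i a 0 i <= 1 /\ x = a *m M].

Definition dilate (R : realType) (d : nat) (c : R) (S : set 'rV[R]_d) : set 'rV[R]_d :=
  [set c *: y | y in S].

(* Hilbert basis of a (pointed) cone K: the irreducible elements of the
   semigroup K ∩ Z^d, i.e. nonzero lattice points of K that are not a sum of
   two nonzero lattice points of K (= its minimal generating set). *)
Definition hilb (R : realType) (d : nat) (K : set 'rV[R]_d) : set 'rV[R]_d :=
  [set x | lattice x /\ K x /\ x != 0 /\
     ~ (exists y z, lattice y /\ K y /\ y != 0 /\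
                    lattice z /\ K z /\ z != 0 /\ x = y + z)].

Definition primitive (d : nat) (z : 'rV[int]_d) : Prop :=
  forall k : int, (forall j : 'I_d, (k %| z ord0 j)%Z) -> `|k| = 1 :> int.

(* multiplicity of the full-dimensional lattice simplex conv(O, rows of E):
   the index of the lattice spanned by the rows, i.e. |det E| (= d! vol). *)
Definition mu (d : nat) (E : 'M[int]_d) : nat := `|\det E|%N.

Definition face_of (R : realType) (d : nat) (F K : set 'rV[R]_d) : Prop :=
  exists l : 'rV[R]_d,
    (forall y, K y -> 0 <= \sum_j y 0 j * l 0 j) /\
    F = K `&` [set y | \sum_j y 0 j * l 0 j = 0].

(* Main.v *)
Require Import Defs.
From HB Require Import structures.
From mathcomp Require Import all_boot all_order all_algebra.
From mathcomp Require Import boolp classical_sets reals.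
From mathcomp Require Import lra ring.
Set Implicit Arguments.
Unset Strict Implicit.
Import Order.TTheory GRing.Theory Num.Theory.
Local Open Scope ring_scope.
Local Open Scope classical_set_scope.

(* Start from the fan consisting of C alone and subdivide stellarly.  If a cone D
   has multiplicity at least 2, its half-open parallelotope contains a nonzero
   lattice point x = sum xi_i v_i; with the linear form L equal to 1 on the
   generators of C, either x or the sum of the v_i with xi_i <> 0 minus x has
   L(x) at most half of S(D), the sum of L over the generators of D.  Subdividing
   at x every cone containing the face carrying x strictly lowers their
   multiplicities and multiplies S by at most 3/2.  Since S(C) = d, every cone
   satisfies S(D) <= d (3/2)^(mu(C) - mu(D)), so every new ray has
   L(x) <= (d/2) (3/2)^(mu(C) - 2). *)

(** * Integral matrices, multiplicity and replacement of a row *)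

Lemma intm_row (R : realType) (m d : nat) (M : 'M[int]_(m, d)) i :
  row i (intm R M) = intv R (row i M).
Proof. by rewrite /intm /intv map_row. Qed.

Lemma intv_inj (R : realType) (d : nat) : injective (@intv R d).
Proof.
move=> u v /matrixP e; apply/matrixP=> i j; have := e i j.
by rewrite !mxE => /intr_inj.
Qed.

Lemma det_intm (R : realType) (d : nat) (D : 'M[int]_d) :
  \det (intm R D) = (\det D)%:~R.
Proof. exact: det_map_mx. Qed.

Lemma intm_unit (R : realType) (d : nat) (D : 'M[int]_d) :
  \det D != 0 -> intm R D \in unitmx.
Proof. by move=> h; rewrite unitmxE det_intm unitfE intr_eq0. Qed.

Lemma mu_natr (R : realType) (d : nat) (D : 'M[int]_d) :
  (mu D)%:R = `|\det (intm R D)|.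
Proof. by rewrite det_intm /mu -intr_norm -abszE. Qed.

Lemma mu_gt0 (d : nat) (D : 'M[int]_d) : (0 < mu D)%N = (\det D != 0).
Proof. by rewrite /mu absz_gt0. Qed.

Lemma row_inj (d : nat) (D : 'M[int]_d) i j :
  \det D != 0 -> row i D = row j D -> i = j.
Proof.
move=> hD e; apply/eqP; apply: contraNT hD => nij.
by rewrite (determinant_alternate nij) // => k; move/rowP/(_ k): e; rewrite !mxE.
Qed.

Definition subst_row (d : nat) (D : 'M[int]_d) (i : 'I_d) (z : 'rV[int]_d) :
    'M[int]_d :=
  \matrix_k (if k == i then z else row k D).

Lemma row_subst (d : nat) (D : 'M[int]_d) i z k :
  row k (subst_row D i z) = if k == i then z else row k D.
Proof. exact: rowK. Qed.

(* Cramer's rule: the new determinant is the [i]-th coordinate of [z *m \adj D]. *)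
Lemma det_subst (R : realType) (d : nat) (D : 'M[int]_d) i z (a : 'rV[R]_d) :
  intv R z = a *m intm R D ->
  \det (intm R (subst_row D i z)) = a 0 i * \det (intm R D).
Proof.
move=> hz; rewrite (expand_det_row _ i).
transitivity ((intv R z *m \adj (intm R D)) 0 i); last first.
  by rewrite hz -mulmxA mul_mx_adj mul_mx_scalar mxE mulrC.
rewrite [RHS]mxE; apply: eq_bigr => j _.
rewrite !mxE eqxx; congr (_ * _).
rewrite /cofactor; congr (_ * \det _).
by apply/matrixP => k l; rewrite !mxE eq_sym (negPf (neq_lift _ _)) !mxE.
Qed.

(** * Coefficient functions on rays *)

(* A point of a simplicial cone is recorded by its coefficients, seen as a
   function on all potential rays; points of different cones of a fan can then
   be compared. *)
Definition coeff (R : realType) (d : nat) (D : 'M[int]_d)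
    (f : 'rV[int]_d -> R) : Prop :=
  (forall v, 0 <= f v) /\ (forall v, (forall i, row i D != v) -> f v = 0).

Definition rep (R : realType) (d : nat) (D : 'M[int]_d)
    (f : 'rV[int]_d -> R) : 'rV[R]_d :=
  \sum_i f (row i D) *: intv R (row i D).

(** A sum over matching rows avoids choosing an index; for independent rows at most one term
    occurs. *)
Definition wt (R : realType) (d : nat) (D : 'M[int]_d) (a : 'rV[R]_d) :
    'rV[int]_d -> R :=
  fun v => \sum_(i | row i D == v) a 0 i.

Lemma wt_row (R : realType) (d : nat) (D : 'M[int]_d) (a : 'rV[R]_d) i :
  \det D != 0 -> wt D a (row i D) = a 0 i.
Proof.
move=> hD; rewrite /wt (bigD1 i) //= big1 ?addr0 // => j /andP[/eqP e].
by rewrite (row_inj hD e) eqxx.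
Qed.

Lemma wt_coeff (R : realType) (d : nat) (D : 'M[int]_d) (a : 'rV[R]_d) :
  (forall i, 0 <= a 0 i) -> coeff D (wt D a).
Proof.
move=> ha; split=> v; first exact: sumr_ge0.
by move=> h; rewrite /wt big_pred0 // => i; apply: negbTE.
Qed.

Lemma rep_wt (R : realType) (d : nat) (D : 'M[int]_d) (a : 'rV[R]_d) :
  \det D != 0 -> rep D (wt D a) = a *m intm R D.
Proof.
move=> hD; rewrite mulmx_sum_row; apply: eq_bigr => i _.
by rewrite wt_row // intm_row.
Qed.

Lemma rep_row (R : realType) (d : nat) (D : 'M[int]_d) (f : 'rV[int]_d -> R) :
  rep D f = (\row_i f (row i D)) *m intm R D.
Proof.
by rewrite mulmx_sum_row; apply: eq_bigr => i _; rewrite intm_row mxE.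
Qed.

Lemma coneP (R : realType) (d : nat) (D : 'M[int]_d) (x : 'rV[R]_d) :
  \det D != 0 ->
  cone (intm R D) x <-> exists f, coeff D f /\ x = rep D f.
Proof.
move=> hD; split=> [[a [ha ->]]|[f [[hf _] ->]]].
  by exists (wt D a); rewrite rep_wt //; split=> //; apply: wt_coeff.
by exists (\row_i f (row i D)); rewrite rep_row; split=> // i; rewrite mxE.
Qed.

(** Independent rows are distinct, so each side runs exactly once through the support of [f], which
    does not depend on the cone. *)
Lemma sum_rays (V : nmodType) (R : realType) (d : nat) (D D' : 'M[int]_d)
    (f : 'rV[int]_d -> R) (h : 'rV[int]_d -> V) :
  \det D != 0 -> \det D' != 0 -> coeff D f -> coeff D' f ->
  \sum_(i | f (row i D) != 0) h (row i D) =
  \sum_(i | f (row i D') != 0) h (row i D').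
Proof.
move=> hD hD' [_ sD] [_ sD'].
pose s (A : 'M[int]_d) :=
  [seq v <- [seq row i A | i <- enum 'I_d] | f v != 0].
have sumE A : \sum_(i | f (row i A) != 0) h (row i A) = \sum_(v <- s A) h v.
  by rewrite big_filter big_map big_enum_cond.
rewrite !sumE; apply: perm_big.
have un A : \det A != 0 -> uniq (s A).
  move=> hA; apply: filter_uniq; rewrite map_inj_uniq ?enum_uniq //.
  by move=> i j; apply: row_inj.
have memE A : (forall v, (forall i, row i A != v) -> f v = 0) ->
    s A =i [pred v | f v != 0].
  move=> hA v; rewrite mem_filter inE; case: (f v =P 0) => //= fv.
  apply/mapP; apply: contrapT => nh; apply: fv; apply: hA => i.
  by apply/eqP => e; apply: nh; exists i; rewrite ?mem_enum.
by apply: uniq_perm; rewrite ?un // => v; rewrite !memE.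
Qed.

Lemma rep_supp (R : realType) (d : nat) (D : 'M[int]_d) (f : 'rV[int]_d -> R) :
  rep D f = \sum_(i | f (row i D) != 0) f (row i D) *: intv R (row i D).
Proof.
rewrite /rep [LHS](bigID (fun i => f (row i D) != 0)) /= [X in _ + X]big1 ?addr0 //.
by move=> i /negPn/eqP->; rewrite scale0r.
Qed.

Lemma rep_indep (R : realType) (d : nat) (D D' : 'M[int]_d)
    (f : 'rV[int]_d -> R) :
  \det D != 0 -> \det D' != 0 -> coeff D f -> coeff D' f -> rep D f = rep D' f.
Proof.
move=> hD hD' cD cD'; rewrite !rep_supp.
exact: (sum_rays (fun v => f v *: intv R v) hD hD' cD cD').
Qed.

(** * Lattice points of the fundamental parallelotope *)

(* If all rows of the inverse of [D] were integral, [D] would be unimodular;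
   so some unit vector has a nonintegral coordinate vector, whose fractional
   part [a] is the desired point.  Replacing [a] by [1 - a] on its support
   yields the inequality, since the two values add up to the right-hand side. *)
Lemma parallelotope_point (R : realType) (d : nat) (D : 'M[int]_d)
    (w : 'I_d -> R) :
  (1 < mu D)%N ->
  exists (z : 'rV[int]_d) (a : 'rV[R]_d),
    [/\ intv R z = a *m intm R D, forall i, 0 <= a 0 i < 1, a != 0 &
        2 * \sum_i a 0 i * w i <= \sum_(i | a 0 i != 0) w i].
Proof.
move=> muD; have hD : \det D != 0 by rewrite -mu_gt0 ltnW.
pose I := invmx (intm R D).
pose N : 'M[int]_d := \matrix_(i, j) Num.floor (I i j).
have [i0 [j0 hij]] : exists i j, I i j != (Num.floor (I i j))%:~R.
  apply: contrapT => nh; move: muD; suff -> : mu D = 1%N by [].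
  have e : intm R N = I.
    apply/matrixP => i j; rewrite !mxE; apply: contrapT => ne; apply: nh.
    by exists i, j; apply/eqP => e; apply: ne.
  have e1 : \det N * \det D = 1.
    apply: (@intr_inj R); rewrite intrM -!det_intm e -det_mulmx mulVmx ?det1 //.
    exact: intm_unit.
  rewrite /mu; apply/eqP; move/(congr1 absz): e1 => /eqP; rewrite abszM muln_eq1.
  by case/andP.
pose z : 'rV[int]_d := row i0 1%:M - row i0 N *m D.
pose a : 'rV[R]_d := \row_j (I i0 j - (Num.floor (I i0 j))%:~R).
have za : intv R z = a *m intm R D.
  have -> : a = row i0 I - intv R (row i0 N).
    by apply/rowP => j; rewrite !mxE.
  rewrite mulmxBl -row_mul mulVmx ?intm_unit // /z.
  apply/rowP => j; rewrite !mxE rmorphB /=; congr (_ - _).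
    by case: (_ == _).
  by rewrite rmorph_sum; apply: eq_bigr => k _; rewrite rmorphM /= !mxE.
have ha i : 0 <= a 0 i < 1.
  by rewrite mxE; have := Num.Theory.floor_itv (I i0 i); rewrite rmorphD /=; lra.
have an0 : a != 0.
  by apply: contraNneq hij => /rowP/(_ j0); rewrite !mxE => /eqP; rewrite subr_eq0.
pose z' : 'rV[int]_d := \sum_(i | a 0 i != 0) row i D - z.
pose a' : 'rV[R]_d := \row_i (if a 0 i != 0 then 1 - a 0 i else 0).
have a0 i : (a' 0 i != 0) = (a 0 i != 0).
  rewrite mxE; case: ifP => //; last by rewrite eqxx.
  by have := ha i; lra.
have [h|h] := leP (2 * \sum_i a 0 i * w i) (\sum_(i | a 0 i != 0) w i).
  by exists z, a.
exists z', a'; split.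
- rewrite /z' /intv map_mxB; apply/eqP; rewrite subr_eq; apply/eqP.
  have -> : map_mx (fun k : int => k%:~R) z = intv R z by [].
  rewrite za -mulmxDl mulmx_sum_row raddf_sum /= big_mkcond /=.
  apply: eq_bigr => i _; rewrite [(a' + a) 0 i]mxE [a' 0 i]mxE intm_row.
  by case: eqP => /= [->|_]; rewrite ?addr0 ?scale0r // subrK scale1r.
- by move=> i; rewrite mxE; have := ha i; case: ifP; lra.
- apply: contraNneq an0 => e; apply/eqP/rowP => i; apply/eqP.
  by rewrite [X in _ == X]mxE -[_ == _]negbK -a0 e mxE eqxx.
rewrite (eq_bigl _ _ a0).
have : \sum_i a' 0 i * w i + \sum_i a 0 i * w i = \sum_(i | a 0 i != 0) w i.
  rewrite -big_split [RHS]big_mkcond /=; apply: eq_bigr => i _.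
  rewrite mxE; case: eqP => /= [->|_]; ring.
by move: h; lra.
Qed.

(** * Stellar subdivision of a fan *)

(* Applied to [D = D'], this says that the cone is simplicial; in general, that
   two cones meet exactly in the cone over their common rays. *)
Definition compatible (R : realType) (d : nat) (D D' : 'M[int]_d) : Prop :=
  forall f f' : 'rV[int]_d -> R,
    coeff D f -> coeff D' f' -> rep D f = rep D' f' -> f =1 f'.

Definition ecoord (R : realType) (d : nat) (E : 'M[int]_d) (v : 'rV[int]_d) :
    'rV[R]_d :=
  intv R v *m invmx (intm R E).

(** The second clause places every ray in the cone over [E]; with the third, the union of the cones
    is exactly that cone. *)
Definition fan_of (R : realType) (d : nat) (E : 'M[int]_d)
    (F : seq 'M[int]_d) : Prop :=
  [/\ forall D, D \in F -> \det D != 0,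
      forall D, D \in F -> forall i j, 0 <= ecoord R E (row i D) 0 j,
      forall x, cone (intm R E) x -> exists2 D, D \in F & cone (intm R D) x &
      forall D D', D \in F -> D' \in F -> compatible R D D'].

(** The bound [xi v < 1] makes multiplicities drop and keeps [z] from being an old ray. *)
Definition center (R : realType) (d : nat) (F : seq 'M[int]_d)
    (D : 'M[int]_d) (z : 'rV[int]_d) (xi : 'rV[int]_d -> R) : Prop :=
  [/\ D \in F, coeff D xi, intv R z = rep D xi, forall v, xi v < 1 &
      exists v, xi v != 0].

(* [coeff D xi] holds exactly when [D] contains the face carrying [xi]. *)
Definition stellar (R : realType) (d : nat) (F : seq 'M[int]_d)
    (z : 'rV[int]_d) (xi : 'rV[int]_d -> R) : seq 'M[int]_d :=
  flatten [seq if `[< coeff D xi >]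
               then [seq subst_row D i z | i <- enum 'I_d & xi (row i D) != 0]
               else [:: D] | D <- F].

Lemma mem_stellar (R : realType) (d : nat) (F : seq 'M[int]_d) z
    (xi : 'rV[int]_d -> R) D' :
  D' \in stellar F z xi <->
  exists2 D, D \in F &
    ~ coeff D xi /\ D' = D \/
    coeff D xi /\ exists2 i, xi (row i D) != 0 & D' = subst_row D i z.
Proof.
split=> [/flattenP[s /mapP[D DF ->]]|[D DF h]].
  case: asboolP => cD; last by rewrite inE => /eqP->; exists D => //; left.
  move=> /mapP[i]; rewrite mem_filter => /andP[hi _] ->.
  by exists D => //; right; split=> //; exists i.
apply/flattenP; eexists; first exact: map_f DF.
case: h => [[ncD ->]|[cD [i hi ->]]].
  by rewrite asboolF ?mem_head.
rewrite asboolT //; apply/mapP; exists i => //.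
by rewrite mem_filter hi mem_enum.
Qed.

Lemma coeff_ray (R : realType) (d : nat) (D : 'M[int]_d)
    (f : 'rV[int]_d -> R) v :
  coeff D f -> f v != 0 -> exists i, v = row i D.
Proof.
move=> [_ s] fv; apply: contrapT => nh; move/eqP: fv; apply; apply: s => i.
by apply/eqP => e; apply: nh; exists i.
Qed.

Lemma center_rep (R : realType) (d : nat) (E : 'M[int]_d) (F : seq 'M[int]_d)
    D0 z (xi : 'rV[int]_d -> R) D :
  fan_of R E F -> center F D0 z xi -> D \in F -> coeff D xi ->
  intv R z = rep D xi.
Proof.
move=> [det0 _ _ _] [D0F cD0 -> _ _] DF cD.
by apply: rep_indep => //; apply: det0.
Qed.

(** If [z] were a ray of [D], the unit coefficient at that ray and [xi] would represent the same
    point; compatibility would then give [xi z = 1]. *)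
Lemma center_new (R : realType) (d : nat) (E : 'M[int]_d) (F : seq 'M[int]_d)
    D0 z (xi : 'rV[int]_d -> R) D i :
  fan_of R E F -> center F D0 z xi -> D \in F -> row i D != z.
Proof.
move=> [det0 _ _ comp] [D0F cD0 zE xi1 _] DF; apply/eqP => e.
have hD := det0 _ DF.
pose a : 'rV[R]_d := \row_j (i == j)%:R.
have ca : coeff D (wt D a) by apply: wt_coeff => j; rewrite mxE ler0n.
have ra : rep D (wt D a) = rep D0 xi.
  rewrite rep_wt // -zE -e -intm_row mulmx_sum_row (bigD1 i) //= mxE eqxx.
  rewrite scale1r big1 ?addr0 // => j ji.
  by rewrite mxE eq_sym (negPf ji) scale0r.
have := xi1 z; rewrite -(comp _ _ DF D0F _ _ ca cD0 ra) -e wt_row //.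
by rewrite mxE eqxx ltxx.
Qed.

(* Rewriting a combination of the new rays in terms of the old ones. *)
Definition expand (R : realType) (d : nat) (z : 'rV[int]_d)
    (xi f : 'rV[int]_d -> R) : 'rV[int]_d -> R :=
  fun v => if v == z then 0 else f v + f z * xi v.

Lemma expand_subst (R : realType) (d : nat) (D : 'M[int]_d) z
    (xi f : 'rV[int]_d -> R) i :
  \det D != 0 -> coeff D xi -> intv R z = rep D xi ->
  (forall k, row k D != z) -> coeff (subst_row D i z) f ->
  [/\ coeff D (expand z xi f),
      rep D (expand z xi f) = rep (subst_row D i z) f & f (row i D) = 0].
Proof.
move=> hD [xi0 xis] zE zD [f0 fs].
have fi : f (row i D) = 0.
  apply: fs => k; rewrite row_subst.
  have [_|ki] := eqVneq k i; first by rewrite eq_sym.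
  by apply: contraNneq ki => /(row_inj hD) ->.
split=> //.
  split=> v; rewrite /expand.
    by case: ifP => // _; rewrite addr_ge0 // mulr_ge0.
  move=> h; case: eqVneq => // vz; rewrite (xis v h) mulr0 addr0.
  apply: fs => k; rewrite row_subst; have [_|//] := eqVneq k i.
  by rewrite eq_sym.
transitivity (\sum_k f (row k D) *: intv R (row k D) + f z *: intv R z).
  rewrite zE /rep scaler_sumr -big_split /=; apply: eq_bigr => k _.
  by rewrite /expand (negPf (zD k)) scalerDl scalerA.
rewrite /rep (bigD1 i) //= fi scale0r add0r [RHS](bigD1 i) //=.
rewrite row_subst eqxx addrC; congr (_ + _); apply: eq_bigr => k ki.
by rewrite row_subst (negPf ki).
Qed.

(** The last clause makes the expansion invertible: the ray with coefficient 0 is the replaced one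
    or, in an untouched cone, a ray of the carrier that the cone lacks. *)
Lemma expand_stellar (R : realType) (d : nat) (E : 'M[int]_d)
    (F : seq 'M[int]_d) D0 z (xi f : 'rV[int]_d -> R) D' :
  fan_of R E F -> center F D0 z xi -> D' \in stellar F z xi -> coeff D' f ->
  exists D, [/\ D \in F, coeff D (expand z xi f),
    rep D (expand z xi f) = rep D' f & exists2 v, xi v != 0 & f v = 0].
Proof.
move=> fF cz /mem_stellar[D DF [[ncD ->]|[cD [i hi ->]]]] cf; exists D.
  have zD := center_new _ fF cz DF; have [f0 fs] := cf.
  have fz : f z = 0 by apply: fs => i; apply: zD.
  have e : expand z xi f = f.
    apply/funext => v; rewrite /expand fz mul0r addr0.
    by case: eqVneq => // ->.
  rewrite e; split=> //.
  apply: contrapT => nh; apply: ncD; split; first by case: cz => _ [].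
  move=> v h; apply: contrapT => /eqP xv; apply: nh; exists v => //.
  exact: fs.
have hD : \det D != 0 by case: fF => + _ _ _; apply.
have zD k := center_new k fF cz DF.
have [? ? fi] := expand_subst hD cD (center_rep fF cz DF cD) zD cf.
by split=> //; exists (row i D).
Qed.

(** Compatibility in [F] makes the two expansions equal to one function g. The coefficient at [z] is
    the minimum of g v / [xi v] over the carrier, attained at a ray whose coefficient is 0; the
    others follow by subtraction. *)
Lemma stellar_compatible (R : realType) (d : nat) (E : 'M[int]_d)
    (F : seq 'M[int]_d) D0 z (xi : 'rV[int]_d -> R) D1 D2 :
  fan_of R E F -> center F D0 z xi ->
  D1 \in stellar F z xi -> D2 \in stellar F z xi -> compatible R D1 D2.
Proof.
move=> fF cz h1 h2 f1 f2 c1 c2 e.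
have [A1 [A1F cA1 r1 [v1 x1 z1]]] := expand_stellar fF cz h1 c1.
have [A2 [A2F cA2 r2 [v2 x2 z2]]] := expand_stellar fF cz h2 c2.
have [D0F cD0 zE _ _] := cz.
have ee : expand z xi f1 =1 expand z xi f2.
  by case: fF => _ _ _ comp; apply: (comp _ _ A1F A2F) => //; rewrite r1 r2.
have xi0 v : 0 <= xi v by case: cD0.
have nz v : xi v != 0 -> v == z = false.
  move=> /(coeff_ray cD0)[i ->]; apply/negbTE; exact: center_new fF cz D0F.
have le g g' v : coeff D1 g \/ coeff D2 g -> expand z xi g =1 expand z xi g' ->
    xi v != 0 -> g' v = 0 -> g z <= g' z.
  move=> cg eg xv gv; have := eg v; rewrite /expand nz // gv add0r => h.
  have xp : 0 < xi v by rewrite lt_neqAle eq_sym xv xi0.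
  rewrite -(ler_pM2r xp) -h lerDr.
  by case: cg => -[].
have ez : f1 z = f2 z.
  have le12 : f1 z <= f2 z by apply: le v2 _ ee x2 z2; left.
  have le21 : f2 z <= f1 z.
    by apply: le v1 _ _ x1 z1; [right | move=> v; rewrite ee].
  by apply/eqP; rewrite eq_le le12.
move=> v; have := ee v; rewrite /expand ez.
by case: eqVneq => [->|_ /addIr].
Qed.

(* Subtract from [y] the largest multiple of [z] that keeps all coefficients
   nonnegative. *)
Lemma stellar_cover (R : realType) (d : nat) (D : 'M[int]_d) z
    (xi : 'rV[int]_d -> R) (y : 'rV[R]_d) :
  coeff D xi -> intv R z = rep D xi -> (exists v, xi v != 0) ->
  cone (intm R D) y ->
  exists2 i, xi (row i D) != 0 & cone (intm R (subst_row D i z)) y.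
Proof.
move=> cD zE [v0 xv0] [a [a0 ->]].
have xi0 v : 0 <= xi v by case: cD.
have [k0 hk0] := coeff_ray cD xv0; rewrite hk0 in xv0.
(* The least ratio is that largest multiple; the ray attaining it loses its coefficient and gives
   way to [z]. *)
case: (@arg_minP _ _ _ k0 (fun i => xi (row i D) != 0)
  (fun i => a 0 i / xi (row i D)) xv0) => i hi mini.
exists i => //; set t := a 0 i / xi (row i D).
have t0 : 0 <= t by rewrite divr_ge0.
exists (\row_k (if k == i then t else a 0 k - t * xi (row k D))); split.
  move=> k; rewrite mxE; case: ifP => // _; rewrite subr_ge0.
  have [->|hk] := eqVneq (xi (row k D)) 0; first by rewrite mulr0.
  have xp : 0 < xi (row k D) by rewrite lt_neqAle eq_sym hk xi0.
  by rewrite -ler_pdivlMr //; apply: mini.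
have tz : t *: intv R z = a 0 i *: intv R (row i D) +
    \sum_(k | k != i) (t * xi (row k D)) *: intv R (row k D).
  rewrite zE /rep scaler_sumr (bigD1 i) //= scalerA divfK //; congr (_ + _).
  by apply: eq_bigr => k _; rewrite scalerA.
rewrite !mulmx_sum_row (bigD1 i) //= [RHS](bigD1 i) //= mxE eqxx !intm_row.
rewrite row_subst eqxx tz -addrA; congr (_ + _).
rewrite -big_split /=; apply: eq_bigr => k ki.
by rewrite mxE (negPf ki) !intm_row row_subst (negPf ki) scalerBl addrC subrK.
Qed.

Lemma ecoord_rep (R : realType) (d : nat) (E D : 'M[int]_d) z
    (xi : 'rV[int]_d -> R) j :
  intv R z = rep D xi ->
  ecoord R E z 0 j = \sum_i xi (row i D) * ecoord R E (row i D) 0 j.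
Proof.
move=> zE; rewrite /ecoord zE /rep mulmx_suml summxE; apply: eq_bigr => i _.
by rewrite -scalemxAl mxE.
Qed.

Lemma stellar_fan (R : realType) (d : nat) (E : 'M[int]_d)
    (F : seq 'M[int]_d) D0 z (xi : 'rV[int]_d -> R) :
  fan_of R E F -> center F D0 z xi -> fan_of R E (stellar F z xi).
Proof.
move=> fF cz; have [det0 pos cov _] := fF; have [D0F cD0 zE _ xn0] := cz.
split; last by move=> D1 D2; apply: stellar_compatible fF cz.
- move=> _ /mem_stellar[D DF [[_ ->]|[cD [i hi ->]]]]; first exact: det0.
  (* By Cramer's rule the determinant gets multiplied by [xi (row i D)], which is nonzero. *)
  rewrite -(intr_eq0 R) -det_intm.
  rewrite (det_subst _ (etrans (center_rep fF cz DF cD) (rep_row D xi))) mxE.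
  by rewrite mulf_neq0 // det_intm intr_eq0 det0.
- move=> _ /mem_stellar[D DF [[_ ->]|[cD [i hi ->]]]]; first exact: pos.
  move=> k j; rewrite row_subst; case: ifP => _; last exact: pos.
  rewrite (ecoord_rep _ _ zE) sumr_ge0 // => l _; rewrite mulr_ge0 //.
    by case: cD0.
  exact: pos.
move=> x /cov[D DF Dx]; have [cD|ncD] := pselect (coeff D xi); last first.
  by exists D => //; apply/mem_stellar; exists D => //; left.
have [i hi ix] := stellar_cover cD (center_rep fF cz DF cD) xn0 Dx.
exists (subst_row D i z) => //; apply/mem_stellar; exists D => //; right.
by split=> //; exists i.
Qed.

Lemma mu_subst (R : realType) (d : nat) (D : 'M[int]_d) z
    (xi : 'rV[int]_d -> R) i :
  \det D != 0 -> coeff D xi -> (forall v, xi v < 1) -> intv R z = rep D xi ->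
  (mu (subst_row D i z) < mu D)%N.
Proof.
move=> hD [xi0 _] xi1 zE; rewrite -(ltr_nat R) !mu_natr.
rewrite (det_subst _ (etrans zE (rep_row D xi))) mxE normrM ger0_norm //.
by rewrite gtr_pMl // normr_gt0 det_intm intr_eq0.
Qed.

Definition weight (d : nat) (F : seq 'M[int]_d) : nat :=
  \sum_(D <- F) d.+1 ^ mu D.

(* A cone of multiplicity [m] is replaced by at most [d] cones of smaller
   multiplicity, and [d * d.+1 ^ m.-1 < d.+1 ^ m]. *)
Lemma weight_stellar (R : realType) (d : nat) (E : 'M[int]_d)
    (F : seq 'M[int]_d) D0 z (xi : 'rV[int]_d -> R) :
  fan_of R E F -> center F D0 z xi ->
  (weight (stellar F z xi) < weight F)%N.
Proof.
move=> fF cz; have [D0F cD0 zE xi1 xn0] := cz; have [det0 _ _ _] := fF.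
rewrite /weight /stellar big_flatten big_map /=.
pose s (D : 'M[int]_d) := if `[< coeff D xi >]
  then [seq subst_row D i z | i <- enum 'I_d & xi (row i D) != 0] else [:: D].
rewrite -[X in (X < _)%N]/(\sum_(D <- F) \sum_(A <- s D) d.+1 ^ mu A)%N.
have lt D : D \in F -> coeff D xi ->
    (\sum_(A <- s D) d.+1 ^ mu A < d.+1 ^ mu D)%N.
  move=> DF cD; rewrite /s asboolT // big_map big_filter.
  have hD := det0 _ DF; have mD : (0 < mu D)%N by rewrite mu_gt0.
  apply: (@leq_ltn_trans (\sum_(i < d) d.+1 ^ (mu D).-1)%N).
    rewrite big_enum_cond big_mkcond /=; apply: leq_sum => i _.
    case: ifP => // _; rewrite leq_pexp2l // -ltnS prednK //.
    exact: mu_subst hD cD xi1 (center_rep fF cz DF cD).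
  rewrite sum_nat_const card_ord -{2}(prednK mD) expnS ltn_pmul2r //.
  by rewrite expn_gt0.
have le D : D \in F -> (\sum_(A <- s D) d.+1 ^ mu A <= d.+1 ^ mu D)%N.
  move=> DF; have [cD|ncD] := pselect (coeff D xi); first exact/ltnW/lt.
  by rewrite /s asboolF // big_seq1.
(* [D0] contains the carrier, so its term drops strictly, while no other term grows. *)
rewrite !(big_rem D0 D0F) /= -addSn leq_add ?lt //.
rewrite big_seq [X in (_ <= X)%N]big_seq; apply: leq_sum => D /mem_rem.
exact: le.
Qed.

(** * Bounding the rays *)

(** The linear form L, equal to 1 on the rows of [E] when these are independent; within the cone
    over [E], a bound c on it cuts out the dilate of the simplex by c. *)
Definition height (R : realType) (d : nat) (E : 'M[int]_d) (v : 'rV[int]_d) : R :=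
  \sum_j ecoord R E v 0 j.

(** The first clause is the growth estimate for S(D) with denominators cleared, so that exponents
    stay natural. *)
Definition bounded_fan (R : realType) (d : nat) (E : 'M[int]_d)
    (F : seq 'M[int]_d) : Prop :=
  forall D, D \in F ->
    (\sum_i height R E (row i D)) * (3 / 2) ^+ mu D <= d%:R * (3 / 2) ^+ mu E /\
    forall i, height R E (row i D) <= d%:R / 2 * (3 / 2) ^ ((mu E)%:Z - 2).

(** The factor 2/9 is 1/2 times (2/3)^2; this removes an exponent that is negative for [m = 1]. *)
Lemma ray_bound (R : realType) (d m : nat) :
  d%:R / 2 * (3 / 2) ^ (m%:Z - 2) = d%:R * (3 / 2) ^+ m * (2 / 9) :> R.
Proof.
rewrite expfzDr; last by apply: lt0r_neq0; lra.
by rewrite -exprnP -exprnN; field.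
Qed.

Lemma height_rep (R : realType) (d : nat) (E D : 'M[int]_d) z
    (xi : 'rV[int]_d -> R) :
  intv R z = rep D xi ->
  height R E z = \sum_i xi (row i D) * height R E (row i D).
Proof.
move=> zE; rewrite /height (eq_bigr _ (fun j _ => ecoord_rep E j zE)).
by rewrite exchange_big; apply: eq_bigr => i _; rewrite mulr_sumr.
Qed.

Lemma stellar_bounded (R : realType) (d : nat) (E : 'M[int]_d)
    (F : seq 'M[int]_d) D0 z (xi : 'rV[int]_d -> R) :
  fan_of R E F -> bounded_fan R E F -> center F D0 z xi ->
  2 * height R E z <=
    \sum_(i | xi (row i D0) != 0) height R E (row i D0) ->
  bounded_fan R E (stellar F z xi).
Proof.
move=> fF bF cz hz _ /mem_stellar[D DF [[_ ->]|[cD [i hi ->]]]]; first exact: bF.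
have [D0F cD0 _ xi1 _] := cz; have [det0 pos _ _] := fF.
have hpos A k : A \in F -> 0 <= height R E (row k A).
  by move=> AF; apply: sumr_ge0 => j _; apply: pos.
(* The carrier consists of rays of [D] too, and the other rays of [D] have nonnegative height. *)
have zS : 2 * height R E z <= \sum_k height R E (row k D).
  apply: le_trans hz _; rewrite (sum_rays (height R E) _ _ cD0 cD) ?det0 //.
  rewrite [leRHS](bigID (fun k => xi (row k D) != 0)) /= lerDl.
  by apply: sumr_ge0 => k _; apply: hpos.
have [SD hD] := bF _ DF.
have mlt := mu_subst i (det0 _ DF) cD xi1 (center_rep fF cz DF cD).
have m1 : (0 < mu (subst_row D i z))%N.
  have [det0' _ _ _] := stellar_fan fF cz.
  rewrite mu_gt0 det0' //; apply/mem_stellar; exists D => //; right.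
  by split=> //; exists i.
set S := \sum_k height R E (row k D) in zS SD.
have gt32 : 1 < 3 / 2 :> R by clear; lra.
have gt0 : 0 < 3 / 2 :> R by clear; lra.
have S0 : 0 <= S by apply: sumr_ge0 => k _; apply: hpos.
split.
  have S' : \sum_k height R E (row k (subst_row D i z)) <= S * (3 / 2).
    rewrite (bigD1 i) //= row_subst eqxx.
    have -> : \sum_(k | k != i) height R E (row k (subst_row D i z)) =
              S - height R E (row i D).
      rewrite /S [X in _ = X - _](bigD1 i) //= addrAC subrr add0r.
      by apply: eq_bigr => k ki; rewrite row_subst (negPf ki).
    move: zS (hpos _ i DF); move: (height R E z) (height _ _ _) => p q.
    by clearbody S; clear; lra.
  apply: le_trans SD; apply: le_trans (ler_wpM2r _ S') _.
    by rewrite exprn_ge0 // ltW.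
  by rewrite -mulrA -exprS ler_wpM2l // ler_weXn2l // ltW.
move=> k; rewrite row_subst; case: ifP => _; last exact: hD.
rewrite ray_bound.
(* The new cone has positive multiplicity below that of [D], so [mu D] is at least 2; the bound on
   [z] is then half of this one. *)
have : S * (3 / 2) ^+ 2 <= d%:R * (3 / 2) ^+ mu E.
  apply: le_trans SD; rewrite ler_wpM2l // ler_weXn2l ?ltW //.
  exact: leq_ltn_trans mlt.
move: zS; move: (height R E z) (d%:R * _) => p q.
by clearbody S; clear; lra.
Qed.

(** * Iterating the subdivision down to multiplicity 1 *)

Lemma refine_fan (R : realType) (d : nat) (E : 'M[int]_d)
    (F : seq 'M[int]_d) D0 :
  fan_of R E F -> bounded_fan R E F -> D0 \in F -> (1 < mu D0)%N ->
  exists F', [/\ fan_of R E F', bounded_fan R E F' & (weight F' < weight F)%N].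
Proof.
move=> fF bF D0F mD; have [det0 _ _ _] := fF; have hD := det0 _ D0F.
have [z [a [za a01 an0 hz]]] :=
  parallelotope_point (fun i => height R E (row i D0)) mD.
pose xi := wt D0 a.
have xiE i : xi (row i D0) = a 0 i by apply: wt_row.
have cD0 : coeff D0 xi by apply: wt_coeff => i; case/andP: (a01 i).
have zE : intv R z = rep D0 xi by rewrite rep_wt.
have cz : center F D0 z xi.
  split=> //.
    move=> v; have [->|/(coeff_ray cD0)[i ->]] := eqVneq (xi v) 0.
      exact: ltr01.
    by rewrite xiE; case/andP: (a01 i).
  have /rV0Pn[i ai] := an0.
  by exists (row i D0); rewrite xiE.
exists (stellar F z xi); split.
- exact: stellar_fan cz.
- apply: stellar_bounded cz _ => //.
  have -> : height R E z = \sum_i a 0 i * height R E (row i D0).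
    by rewrite (height_rep E zE); apply: eq_bigr => i _; rewrite xiE.
  by rewrite [leRHS](eq_bigl (fun i => a 0 i != 0)) // => i; rewrite xiE.
exact: weight_stellar fF cz.
Qed.

Lemma unimodular_fan (R : realType) (d : nat) (E : 'M[int]_d)
    (F : seq 'M[int]_d) :
  fan_of R E F -> bounded_fan R E F ->
  exists F', [/\ fan_of R E F', bounded_fan R E F' &
                 forall D, D \in F' -> mu D = 1%N].
Proof.
have [n] := ubnP (weight F); elim: n F => // n IH F wF fF bF.
have [[D DF mD]|nD] := pselect (exists2 D, D \in F & (1 < mu D)%N).
  have [F' [fF' bF' w']] := refine_fan fF bF DF mD.
  by apply: IH fF' bF'; apply: leq_trans w' _.
exists F; split=> // D DF; apply/eqP; rewrite eqn_leq mu_gt0 leqNgt.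
by have [-> // _ _ _] := fF; rewrite andbT; apply/negP => mD; apply: nD; exists D.
Qed.

Lemma ecoord_row (R : realType) (d : nat) (E : 'M[int]_d) i j :
  \det E != 0 -> ecoord R E (row i E) 0 j = (i == j)%:R.
Proof.
move=> hE; rewrite /ecoord -intm_row -row_mul mulmxV ?intm_unit //.
by rewrite !mxE.
Qed.

Lemma fan_of1 (R : realType) (d : nat) (E : 'M[int]_d) :
  \det E != 0 -> fan_of R E [:: E].
Proof.
move=> hE; split.
- by move=> D; rewrite inE => /eqP->.
- by move=> D; rewrite inE => /eqP-> i j; rewrite ecoord_row // ler0n.
- by move=> x Ex; exists E => //; rewrite inE.
move=> D D'; rewrite !inE => /eqP-> /eqP-> f f' [_ s] [_ s'].
rewrite !rep_row => /(can_inj (mulmxK (intm_unit R hE)))/rowP e v.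
have [[i ->]|nv] := pselect (exists i, v = row i E).
  by have := e i; rewrite !mxE.
have nr i : row i E != v by apply/eqP => h; apply: nv; exists i.
by rewrite s ?s'.
Qed.

(** Generators have height 1, and the bound is smallest at multiplicity 1, where it equals d/3;
    hence the condition on [d]. *)
Lemma bounded_fan1 (R : realType) (d : nat) (E : 'M[int]_d) :
  (3 <= d)%N -> \det E != 0 -> bounded_fan R E [:: E].
Proof.
move=> hd hE D; rewrite inE => /eqP->.
have h1 i : height R E (row i E) = 1.
  rewrite /height (bigD1 i) //= ecoord_row // eqxx big1 ?addr0 // => j ji.
  by rewrite ecoord_row // eq_sym (negPf ji).
split; first by rewrite (eq_bigr _ (fun i _ => h1 i)) sumr_const card_ord.
move=> i; rewrite h1 ray_bound.
have d3 : 3 <= d%:R :> R by rewrite (ler_nat _ 3).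
have m3 : 3 / 2 <= (3 / 2) ^+ mu E :> R.
  by rewrite -{1}[3 / 2]expr1 ler_weXn2l ?mu_gt0 //; clear; lra.
move: d3 m3; move: (d%:R : R) ((3 / 2) ^+ mu E) => p q.
by clear; nra.
Qed.

(** * Cones, faces and Hilbert bases *)

Lemma cone_scale (R : realType) (m d : nat) (M N : 'M[R]_(m, d)) :
  (forall i, exists c : R, 0 < c /\ row i M = c *: row i N) ->
  cone M `<=` cone N.
Proof.
move=> h; have [c hc] := choice h; move=> _ [a [a0 ->]].
exists (\row_i (a 0 i * c i)); split.
  by move=> i; rewrite mxE mulr_ge0 // ltW //; case: (hc i).
rewrite !mulmx_sum_row; apply: eq_bigr => i _; case: (hc i) => _ ->.
by rewrite mxE scalerA.
Qed.

(** Lattice points have integral coordinates in a unimodular cone, so a nonzero one has a coordinate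
    at least 1. Subtracting that generator stays in the cone, and irreducibility leaves remainder
    0. *)
Lemma hilb_unimodular (R : realType) (d : nat) (U : 'M[int]_d) x :
  mu U = 1%N -> hilb (cone (intm R U)) x -> exists i, x = intv R (row i U).
Proof.
move=> mU [[z xz] [[a [a0 xa]] [xn0 irr]]].
have hU : \det U != 0 by rewrite -mu_gt0 mU.
have uU : U \in unitmx.
  by rewrite unitmxE [\det U]intEsign -/(mu U) mU mulr1 unitrX ?unitrN1.
pose b := z *m invmx U.
have ab : a = intv R b.
  apply: (can_inj (mulmxK (intm_unit R hU))).
  by rewrite -xa xz /intv /intm -map_mxM /b mulmxKV.
have /rV0Pn[i ai] : a != 0 by apply: contraNneq xn0 => e; rewrite xa e mul0mx.
have a1 : 1 <= a 0 i.
  move: ai (a0 i); rewrite ab mxE intr_eq0 ler0z => bi b0.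
  by rewrite (ler_int _ 1) -gtz0_ge1 lt_neqAle eq_sym bi.
exists i; apply: contrapT => nx; apply: irr.
have rn0 : row i U != 0.
  apply: contraNneq hU => e; rewrite (expand_det_row _ i) big1 // => j _.
  by move/rowP/(_ j): e; rewrite !mxE => ->; rewrite mul0r.
exists (intv R (row i U)), (x - intv R (row i U)); split; last split.
- by exists (row i U).
- exists (delta_mx 0 i); split; first by move=> j; rewrite mxE ler0n.
  by rewrite -rowE intm_row.
split.
  apply: contraNneq rn0 => e; apply/eqP/(@intv_inj R); rewrite e.
  by apply/rowP => j; rewrite !mxE.
split; first by exists (z - row i U); rewrite xz /intv map_mxB.
split.
  exists (a - delta_mx 0 i); split; last by rewrite mulmxBl -xa -rowE intm_row.
  move=> j; rewrite !mxE /=; have [->|_] := eqVneq j i; rewrite ?subr_ge0 ?subr0 //.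
split; first by rewrite subr_eq0; apply/eqP.
by rewrite addrC subrK.
Qed.

(* The functional takes the value [0] on the common rays and [1] on the other
   rays of [D]. *)
Lemma compatible_face (R : realType) (d : nat) (D D' : 'M[int]_d) :
  \det D != 0 -> \det D' != 0 -> compatible R D D' ->
  face_of (cone (intm R D) `&` cone (intm R D')) (cone (intm R D)).
Proof.
move=> hD hD' comp.
pose b : 'cV[R]_d := \col_i (~~ [exists k, row k D' == row i D])%:R.
pose l := (invmx (intm R D) *m b)^T.
have lE (a : 'rV[R]_d) :
    \sum_j (a *m intm R D) 0 j * l 0 j = \sum_i a 0 i * b i 0.
  transitivity ((a *m intm R D *m (invmx (intm R D) *m b)) 0 0).
    by rewrite [RHS]mxE; apply: eq_bigr => j _; rewrite [l 0 j]mxE.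
  by rewrite mulmxA mulmxK ?intm_unit // mxE.
have ab0 (a : 'rV[R]_d) i : (forall i, 0 <= a 0 i) -> 0 <= a 0 i * b i 0.
  by move=> a0; rewrite mulr_ge0 // mxE ler0n.
exists l; split=> [_ [a [a0 ->]]|].
  by rewrite lE sumr_ge0 // => i _; apply: ab0.
apply/seteqP; split=> y [Dy]; split=> //=; move: Dy => [a [a0 yE]]; subst y.
  have [f' [cf' e]] : exists f, coeff D' f /\ a *m intm R D = rep D' f.
    exact/coneP.
  (* On a ray of [D] that is not common, compatibility equates the coefficient with one taken over
     [D'], which is 0 there. *)
  rewrite lE big1 // => i _; rewrite mxE; case: existsP => /= nk; last first.
    have fi : f' (row i D) = a 0 i.
      rewrite -(wt_row a i hD); symmetry; apply: comp => //.
        exact: wt_coeff.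
      by rewrite rep_wt.
    rewrite mulr1 -fi; apply: (cf'.2) => k; apply/negP => h; apply: nk.
    by exists k.
  by rewrite mulr0.
(* [b0] says that the functional vanishes at the point; only common rays then carry coefficients,
   and these serve over [D'] as well. *)
move/eqP: b0; rewrite lE psumr_eq0; last by move=> i _; apply: ab0.
move=> /allP z0; apply/coneP => //; exists (wt D a).
have ca : coeff D (wt D a) by apply: wt_coeff.
have ca' : coeff D' (wt D a).
  split; first by case: ca.
  move=> v hv; apply: contrapT => /eqP vn0.
  have [i vi] := coeff_ray ca vn0; move: vn0; rewrite vi wt_row // => ai.
  have := z0 i (mem_index_enum i); rewrite /= mulf_eq0 (negPf ai) /= mxE.
  case: existsP => [[k /eqP hk]|_]; last by rewrite oner_eq0.
  by have := hv k; rewrite vi hk eqxx.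
by split=> //; rewrite -rep_wt //; apply: rep_indep.
Qed.

(* C = cone over the rows of W (d linearly independent integer vectors);
   the rows of E are the extreme integral generators of C (primitive lattice
   vectors on the edges).  D_t = cone over the rows of U t, whose rows are
   its extreme integral generators; D_t unimodular means mu(Delta_{D_t}) = 1. *)
Theorem theorem4p1 (R : realType) (d : nat) (hd : (3 <= d)%N)
  (W E : 'M[int]_d) (hW : \det W != 0)
  (hE : forall i : 'I_d, primitive (row i E) /\
          exists c : R, 0 < c /\ row i (intm R E) = c *: row i (intm R W)) :
  exists (T : nat) (U : 'I_T -> 'M[int]_d),
    (forall t, mu (U t) = 1%N) /\
    cone (intm R W) = [set x | exists t, cone (intm R (U t)) x] /\
    (forall s t,
        face_of (cone (intm R (U s)) `&` cone (intm R (U t))) (cone (intm R (U s))) /\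
        face_of (cone (intm R (U s)) `&` cone (intm R (U t))) (cone (intm R (U t)))) /\
    (forall t, hilb (cone (intm R (U t))) `<=`
       dilate ((d%:R / 2) * (3 / 2) ^ ((mu E)%:Z - 2)) (simplex0 (intm R E))).
Proof.
have hc i : exists c : R, 0 < c /\ row i (intm R E) = c *: row i (intm R W).
  by case: (hE i).
have hc' i : exists c : R, 0 < c /\ row i (intm R W) = c *: row i (intm R E).
  have [c [c0 ->]] := hc i; exists c^-1; rewrite invr_gt0 c0 scalerA mulVf ?scale1r //.
  exact: lt0r_neq0.
have hdE : \det E != 0.
  have [c cP] := choice hc.
  have e : intm R E = diag_mx (\row_i c i) *m intm R W.
    apply/row_matrixP => i; rewrite (cP i).2 row_mul row_diag_mx mxE.
    by rewrite -scalemxAl -rowE.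
  rewrite -(intr_eq0 R) -det_intm e det_mulmx det_diag mulf_neq0 //; last first.
    by rewrite det_intm intr_eq0.
  by apply/prodf_neq0 => i _; rewrite mxE lt0r_neq0 // (cP i).1.
have [F [[det0 pos cov comp] bF mF]] :=
  unimodular_fan (fan_of1 R hdE) (bounded_fan1 R hd hdE).
pose U (t : 'I_(size F)) := nth 0 F t.
have UF t : U t \in F by rewrite mem_nth.
have WE : cone (intm R W) = cone (intm R E).
  by apply/seteqP; split; apply: cone_scale.
exists (size F), U; split; first by move=> t; apply: mF.
split.
  rewrite WE; apply/seteqP; split=> x /=.
    move=> /cov[D DF Dx]; have lt : (index D F < size F)%N by rewrite index_mem.
    by exists (Ordinal lt); rewrite /U /= nth_index.
  move=> [t [a [a0 ->]]]; exists (a *m intm R (U t) *m invmx (intm R E)).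
  rewrite mulmxKV ?intm_unit //; split=> // j.
  rewrite [a *m _]mulmx_sum_row mulmx_suml summxE sumr_ge0 // => i _.
  by rewrite intm_row -scalemxAl mxE mulr_ge0 //; apply: pos.
split.
  by move=> s t; split; last rewrite setIC; apply: compatible_face; auto.
move=> t x hx; have [i ->] := hilb_unimodular (mF _ (UF t)) hx.
(* The coordinates of the ray with respect to [E], divided by [B], are nonnegative with sum at most
   1. *)
set B := (X in dilate X); have [_ /(_ i)] := bF _ (UF t); rewrite -/B => hB.
have B0 : 0 < B.
  have d0 : 0 < d%:R :> R by rewrite ltr0n ltnW // ltnW.
  by rewrite /B ray_bound; do ?[apply: mulr_gt0 | apply: exprn_gt0]; rewrite ?invr_gt0.
exists (B^-1 *: intv R (row i (U t))); last first.
  by rewrite scalerA divff ?scale1r // lt0r_neq0.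
exists (B^-1 *: ecoord R E (row i (U t))); split; last split.
- by move=> j; rewrite mxE mulr_ge0 ?invr_ge0 ?(ltW B0) //; apply: pos.
- under eq_bigr do rewrite mxE.
  by rewrite -mulr_sumr mulrC ler_pdivrMr // mul1r.
by rewrite -scalemxAl mulmxKV // intm_unit.
Qed.
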